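(* Let $(E,\leqslant,\mathfrak{c})$ be an enriched qoset. Assume that $\mathfrak{c}$ is idempotent and preinductive. Then $K:=\mathrm{kit}_{\mathfrak{c}}E$ is $\mathfrak{c}^{\uparrow}$-closed and has the Krein--Milman property with respect to $\mathfrak{c}^{\uparrow}$, i.e. $$K=\mathfrak{c}^{\uparrow}(\mathrm{ex}_{\mathfrak{c}^{\uparrow}}K).$$ Moreover, for every $x\in \mathrm{kit}_{\mathfrak{c}}E$: (a) there exists an antichain $Y_x\subseteq \mathrm{cp}_{\mathfrak{c}}E$ such that $x\in\mathfrak{c}(Y_x)\cap Y_x^{\uparrow}$; (b) this antichain is unique up to order-equivalence; (c) if $\mathfrak{c}$ is finitary, every such antichain is finite. In addition, if $\mathfrak{c}$ separates points, then $\mathrm{kit}_{\mathfrak{c}}E$ is sup-generated by the subset $\mathrm{cp}_{\mathfrak{c}}E$ of $\mathfrak{c}$-compact points, and $x\in Y_x^{\vee}$ for all $x\in\mathrm{kit}_{\mathfrak{c}}E$.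
   Context: A qoset $(E,\leqslant)$ is a set with a reflexive transitive relation; $x\sim y$ means $x\leqslant y$ and $y\leqslant x$ (''order-equivalent''); $[x]$ is the $\sim$-class of $x$. $\downarrow A=\{x:\exists a\in A,\,x\leqslant a\}$, $\uparrow A$ is defined dually, and $\downarrow x=\downarrow\{x\}$, $\uparrow x=\uparrow\{x\}$. $B^{\uparrow}$ is the set of upper bounds of $B$, and $B^{\vee}$ is the set of all suprema (least upper bounds) of $B$ in $E$. A preclosure operator on $E$ is a map $\mathfrak{c}:2^E\to2^E$ with $A\subseteq\mathfrak{c}(A)\subseteq\mathfrak{c}(B)$ whenever $A\subseteq B$; it need not satisfy $\mathfrak{c}(\emptyset)=\emptyset$. It is idempotent if $\mathfrak{c}(\mathfrak{c}(A))=\mathfrak{c}(A)$ for all $A$, and finitary if $\mathfrak{c}(A)=\bigcup\{\mathfrak{c}(F):F\subseteq A \text{ finite}\}$ for all $A$. A subset $A$ is $\mathfrak{c}$-closed if $\mathfrak{c}(A)=A$. An enriched qoset $(E,\leqslant,\mathfrak{c})$ is a qoset with a preclosure operator $\mathfrak{c}$ such that $\downarrow\mathfrak{c}(A)=\mathfrak{c}(A)$ for all $A\subseteq E$. A $\mathfrak{c}$-copoint of $x\in E$ is an inclusion-maximal element of $\{V\subseteq E: V\ \mathfrak{c}\text{-closed},\ x\notin V\}$; then $x$ is called a $\mathfrak{c}$-attaching point of this copoint. $\mathfrak{c}$ is preinductive if, for every $x\in E$, every $\mathfrak{c}$-closed set not containing $x$ is contained in a $\mathfrak{c}$-copoint of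 $x$. A $\mathfrak{c}$-compact point of $E$ is an $x\in E$ with $x\notin\mathfrak{c}(E\setminus\uparrow x)$; their set is $\mathrm{cp}_{\mathfrak{c}}E$. A $\mathfrak{c}$-kit point of $E$ is an $x\in E$ such that every $\mathfrak{c}$-copoint of $x$ has a $\mathfrak{c}$-attaching point that is $\mathfrak{c}$-compact; their set is $\mathrm{kit}_{\mathfrak{c}}E$. The preclosure operator $\mathfrak{c}^{\uparrow}$ is defined by $\mathfrak{c}^{\uparrow}(A)=\bigcap_{B\subseteq E}\big(\mathfrak{c}(A\cap B)\cup\uparrow(A\setminus B)\big)$. For a preclosure operator $\mathfrak{t}$ and $A\subseteq E$, $\mathrm{ex}_{\mathfrak{t}}A=\{x\in A: x\notin\mathfrak{t}(A\setminus[x])\}$. An antichain is a subset $A$ such that $a\leqslant a'$ implies $a=a'$ for all $a,a'\in A$. ''Unique up to order-equivalence'' means that for any two such antichains $Y,Z$ there is a bijection $\sigma:Z\to Y$ with $z\sim\sigma(z)$ for all $z\in Z$. $\mathfrak{c}$ separates points if, whenever $x\not\leqslant y$, there is a $\mathfrak{c}$-closed $V$ with $y\in V$ and $x\notin V$. A set $K$ is sup-generated by $A\subseteq K$ if $x\in(\downarrow x\cap A)^{\vee}$ for all $x\in K$. *)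

(* Defs.v *)
From HB Require Import structures.
From mathcomp Require Import all_boot all_order.
From mathcomp Require Import boolp classical_sets functions cardinality.

Set Implicit Arguments.
Unset Strict Implicit.
Unset Printing Implicit Defensive.

Local Open Scope classical_set_scope.
Local Open Scope order_scope.

(* Qosets are modelled by [preorderType]. The [ubound], [supremums] and [down]
   of classical_sets require a [porderType], hence the versions below. *)
Section Qoset.
Context {d : Order.disp_t} {E : preorderType d}.
Implicit Types (x y : E) (A B K Y Z : set E).

Definition order_equiv x y : Prop := x <= y /\ y <= x.

Definition order_class x : set E := [set y | order_equiv x y].

Definition downset A : set E := [set x | exists2 a, A a & x <= a].

Definition upset A : set E := [set x | exists2 a, A a & a <= x].

Definition upper_bounds B : set E := [set u | forall b, B b -> b <= u].

(* The set of all least upper bounds of B: in a qoset these are unique only up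
   to order-equivalence. *)
Definition suprema B : set E :=
  [set s | upper_bounds B s /\ forall u, upper_bounds B u -> s <= u].

Definition antichain A : Prop := forall a b, A a -> A b -> a <= b -> a = b.

Definition unique_up_to_order_equiv (P : set E -> Prop) : Prop :=
  forall Y Z, P Y -> P Z ->
    exists sigma : E -> E,
      set_bij Z Y sigma /\ forall z, Z z -> order_equiv z (sigma z).

Definition sup_generated K A : Prop :=
  A `<=` K /\ forall x, K x -> suprema (downset [set x] `&` A) x.

End Qoset.

Section Preclosure.
Context {d : Order.disp_t} {E : preorderType d}.
Variable c : set E -> set E.
Implicit Types (x y : E) (A B K V W Y : set E).

Definition preclosure : Prop :=
  forall A B, A `<=` B -> A `<=` c A /\ c A `<=` c B.

Definition enriched : Prop :=
  preclosure /\ forall A, downset (c A) = c A.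

Definition idempotent_preclosure : Prop := forall A, c (c A) = c A.

Definition finitary : Prop :=
  forall A, c A = \bigcup_(F in [set F | finite_set F /\ F `<=` A]) c F.

Definition pclosed A : Prop := c A = A.

Definition copoint x V : Prop :=
  [/\ pclosed V, ~ V x & forall W, pclosed W -> ~ W x -> V `<=` W -> W = V].

Definition attaching_point V x : Prop := copoint x V.

Definition preinductive : Prop :=
  forall x V, pclosed V -> ~ V x -> exists2 W, copoint x W & V `<=` W.

Definition compact_points : set E :=
  [set x | ~ c (setT `\` upset [set x]) x].

Definition kit_points : set E :=
  [set x | forall V, copoint x V ->
             exists2 p, attaching_point V p & compact_points p].

Definition up_preclosure A : set E :=
  \bigcap_B (c (A `&` B) `|` upset (A `\` B)).

Definition extreme_points A : set E :=
  [set x | A x /\ ~ c (A `\` order_class x) x].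

Definition krein_milman K : Prop := K = c (extreme_points K).

Definition separates_points : Prop :=
  forall x y, ~ (x <= y) -> exists V, [/\ pclosed V, V y & ~ V x].

Definition representing_antichain x Y : Prop :=
  [/\ antichain Y, Y `<=` compact_points & (c Y `&` upper_bounds Y) x].

End Preclosure.

(* Main.v *)
Require Import Defs.
From mathcomp Require Import all_boot all_order.
From mathcomp Require Import boolp classical_sets functions cardinality.

(** A point [p] is compact exactly when the complement of its principal filter
    is closed, and this complement is then the only copoint of [p]
    ([compactP], [copoint_compactE]). Hence the copoints of a kit point [x] are
    complements of the principal filters of certain compact points [p <= x],
    and everything is read off from these points.

    They generate [x]: if their closure [c P] missed [x], preinductivity would
    give a copoint of [x] above [c P]; but that copoint misses one of them.
    Keeping one point per order-class gives a representing antichain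
    ([kit_representing]); it is an antichain because two complements of
    filters, both maximal among the closed sets without [x], are equal as soon
    as one contains the other.

    Conversely, let [Y] be any representing antichain of [x]. A copoint [V] of
    [x] cannot contain [Y], so it misses some [y] in [Y], and by maximality it
    is the complement of the filter of [y] ([representing_copointE]).
    Consequently a set of compact points below [x] is dominated by every other
    such set that generates [x] ([representing_dominates]). For two antichains
    this domination is mutual, which gives uniqueness; for a finite generating
    part of an antichain it shows that this part is the whole antichain.

    As for [up_preclosure c], compact points are extreme in the set of kit
    points, and a kit point lies in the hull of the compact points through its
    representing antichain: either the antichain is contained in the test set
    [B], or one of its members outside [B] lies below the point.

    If [c] separates points, an upper bound [u] of [Y] not above [x] would lie
    in a closed set without [x]; this set contains [Y], hence [c Y] and [x].
    So [x] is a supremum of [Y]. *)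

Set Implicit Arguments.
Unset Strict Implicit.
Unset Printing Implicit Defensive.

Import Order.TTheory.

(** * Antichains in a qoset *)

Section Antichains.
Local Open Scope classical_set_scope.
Local Open Scope order_scope.
Context {d : Order.disp_t} {E : preorderType d}.
Implicit Types (x y : E) (P Y Z : set E).

Lemma order_class_eq x y : order_equiv x y -> order_class x = order_class y.
Proof.
move=> [xy yx]; apply/seteqP; split=> z [] h1 h2; split.
- exact: le_trans yx h1.
- exact: le_trans h2 xy.
- exact: le_trans xy h1.
- exact: le_trans h2 yx.
Qed.

Lemma exists_transversal P :
  exists Y, [/\ Y `<=` P,
    forall p, P p -> exists2 y, Y y & order_equiv p y
    & forall y z, Y y -> Y z -> order_equiv y z -> y = z].
Proof.
case: (pselect (exists x, P x)) => [[x0 _]|P0]; last first.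
  by exists set0; split=> // p Pp; case: P0; exists p.
pose rep x := xget x0 (P `&` order_class x).
have repP x : P x -> (P `&` order_class x) (rep x).
  by move=> Px; apply: (@xgetPex _ _ (P `&` order_class x)); exists x.
exists (rep @` P); split.
- by move=> _ [p Pp <-]; have [] := repP _ Pp.
- by move=> p Pp; exists (rep p); [exists p | have [] := repP _ Pp].
- move=> _ _ [p Pp <-] [q Pq <-] pq.
  have [_ /order_class_eq ep] := repP _ Pp.
  have [_ /order_class_eq e'] := repP _ Pq.
  have e : order_class p = order_class q by rewrite ep e' (order_class_eq pq).
  by rewrite /rep e.
Qed.

(** In two antichains that dominate each other, going up from one and back
    ends where it started, so all the comparisons are order-equivalences. *)
Lemma antichain_bijection Y Z : antichain Y -> antichain Z ->
  (forall z, Z z -> exists2 y, Y y & z <= y) ->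
  (forall y, Y y -> exists2 z, Z z & y <= z) ->
  exists sigma : E -> E,
    set_bij Z Y sigma /\ forall z, Z z -> order_equiv z (sigma z).
Proof.
move=> aY aZ ZY YZ.
have ZYe z : Z z -> exists y, Y y /\ order_equiv z y.
  move=> Zz; have [y Yy zy] := ZY _ Zz; have [z' Zz' yz'] := YZ _ Yy.
  have ez : z = z' by apply: aZ => //; exact: le_trans zy yz'.
  by exists y; split=> //; split=> //; rewrite ez.
have /choice [sigma sP] : forall z, exists y, Z z -> Y y /\ order_equiv z y.
  move=> z; case: (pselect (Z z)) => [/ZYe[y yP]|nZ]; first by exists y.
  by exists z.
exists sigma; split; last by move=> z /sP[].
split.
- by move=> z /sP[].
- move=> z z' /set_mem Zz /set_mem Zz' e; apply: aZ => //.
  have [_ [zs _]] := sP _ Zz; have [_ [_ sz']] := sP _ Zz'.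
  by apply: le_trans zs _; rewrite e.
- move=> y Yy; have [z Zz yz] := YZ _ Yy; exists z => //.
  have [Ysz [zs _]] := sP _ Zz.
  by apply/esym/aY => //; exact: le_trans yz zs.
Qed.

End Antichains.

(** * Copoints and compact points *)

Section Copoints.
Local Open Scope classical_set_scope.
Local Open Scope order_scope.
Context {d : Order.disp_t} {E : preorderType d}.
Context {c : set E -> set E} (c_enriched : enriched c).
Implicit Types (x y p : E) (A B V W Y Z : set E).

Lemma sub_closure A : A `<=` c A.
Proof. by have [+ _] := c_enriched => /(_ A A) []. Qed.

Lemma closure_mono A B : A `<=` B -> c A `<=` c B.
Proof. by have [+ _] := c_enriched => /(_ A B) /[apply] -[]. Qed.

Lemma closure_sub A V : pclosed c V -> A `<=` V -> c A `<=` V.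
Proof. by move=> cV AV; rewrite -cV; exact: closure_mono. Qed.

Lemma closure_down A x y : c A y -> x <= y -> c A x.
Proof. by move=> cy xy; rewrite -c_enriched.2; exists y. Qed.

Lemma pclosed_down V x y : pclosed c V -> V y -> x <= y -> V x.
Proof. by move=> <-; exact: closure_down. Qed.

Definition not_above p : set E := [set x | ~ (p <= x)].

Lemma not_aboveE p : setT `\` upset [set p] = not_above p.
Proof.
apply/seteqP; split=> x /=; first by move=> [_ px] le; apply: px; exists p.
by move=> px; split=> // -[_ -> ].
Qed.

(** A closed set without [p] is a down-set, so it misses the filter of [p]. *)
Lemma pclosed_not_above V p : pclosed c V -> ~ V p -> V `<=` not_above p.
Proof. by move=> cV Vp x Vx px; apply: Vp; exact: pclosed_down px. Qed.

Lemma compactP p : compact_points c p <-> pclosed c (not_above p).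
Proof.
have -> : compact_points c p = (~ c (not_above p) p) by rewrite -not_aboveE.
split=> [cp|->]; last by apply.
apply/seteqP; split; last exact: sub_closure.
by move=> x cx px; apply: cp; exact: closure_down px.
Qed.

Lemma copoint_compactE p V : compact_points c p -> copoint c p V ->
  V = not_above p.
Proof.
move=> /compactP cp [cV Vp maxV]; apply/esym/maxV => //; first by apply.
exact: pclosed_not_above.
Qed.

Lemma compact_kit : compact_points c `<=` kit_points c.
Proof. by move=> p cp V Vp; exists p. Qed.

(** Maximality turns the inclusion of a copoint of [x] in the closed set
    [not_above y] into an equality. *)
Lemma copoint_not_aboveE x y V : copoint c x V -> compact_points c y ->
  y <= x -> ~ V y -> V = not_above y.
Proof.
move=> [cV Vx maxV] /compactP cy yx Vy; apply/esym/maxV => //.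
exact: pclosed_not_above.
Qed.

(** * Representing antichains *)

Lemma representing_copointE x Y V : Y `<=` compact_points c ->
  c Y x -> upper_bounds Y x -> copoint c x V -> exists2 y, Y y & V = not_above y.
Proof.
move=> cY cYx Yx copV; have [cV Vx _] := copV.
have [y Yy Vy] : exists2 y, Y y & ~ V y.
  apply: contrapT => nY; apply: Vx; apply: (closure_sub cV) cYx => y Yy.
  by apply: contrapT => Vy; apply: nY; exists y.
by exists y => //; apply: copoint_not_aboveE copV _ _ Vy; [exact: cY | exact: Yx].
Qed.

Section Preinductive.
Context (c_preinductive : preinductive c).

(** The closed set [not_above p] extends to a copoint of [x], which is
    [not_above y] for some [y] in [Y]; inclusion of the complements of the
    filters means [p <= y]. *)
Lemma representing_dominates x p Y : Y `<=` compact_points c ->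
  c Y x -> upper_bounds Y x -> compact_points c p -> p <= x ->
  exists2 y, Y y & p <= y.
Proof.
move=> cY cYx Yx /compactP cp px.
have [|W copW pW] := c_preinductive (x := x) cp; first by apply.
have [y Yy We] := representing_copointE cY cYx Yx copW.
exists y => //; apply: contrapT => npy.
by have : W y by [exact: pW]; rewrite We; apply.
Qed.

Lemma representing_unique x :
  unique_up_to_order_equiv (representing_antichain c x).
Proof.
move=> Y Z [aY cY [cYx Yx]] [aZ cZ [cZx Zx]].
apply: antichain_bijection => // p pP.
- by apply: (representing_dominates cY cYx Yx); [exact: cZ | exact: Zx].
- by apply: (representing_dominates cZ cZx Zx); [exact: cY | exact: Yx].
Qed.

(** A finite [F] in [Y] with [x] in [c F] dominates [Y], and in an antichain
    only the whole set does. *)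
Lemma representing_finite x Y : finitary c ->
  representing_antichain c x Y -> finite_set Y.
Proof.
move=> cfin [aY cY [cYx Yx]].
have : c Y x by [].
rewrite cfin => -[F [finF FY] cFx]; apply: sub_finite_set finF => y Yy.
have [||||f Ff yf] := @representing_dominates x y F _ cFx.
- exact: subset_trans cY.
- by move=> f /FY; exact: Yx.
- exact: cY.
- exact: Yx.
- by rewrite (aY _ _ Yy (FY _ Ff) yf).
Qed.

(** If [c Y] missed [x], a copoint of [x] above [c Y] would be [not_above p]
    with [p] equivalent to a member of [Y], and so would contain [p]. *)
Lemma kit_representing (c_idem : idempotent_preclosure c) x :
  kit_points c x -> exists Y, representing_antichain c x Y.
Proof.
move=> kx.
pose P := [set p | compact_points c p /\ copoint c x (not_above p)].
have [Y [YP PY Yinj]] := exists_transversal P.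
have Px p : P p -> p <= x by move=> [_ [_ npx _]]; exact: contrapT.
exists Y; split; [| by move=> y /YP [] | split; last by move=> y /YP /Px].
- move=> y z Yy Yz yz; apply: Yinj => //; split=> //.
  have [_ [_ _ max]] := YP _ Yy; have [cz [_ nzx _]] := YP _ Yz.
  have eyz : not_above z = not_above y.
    apply: max => //; first exact/compactP.
    by move=> u nyu zu; apply: nyu; exact: le_trans yz zu.
  apply: contrapT => nzy; have : not_above y y by rewrite -eyz.
  by apply.
- apply: contrapT => ncY.
  have [V copV cYV] := c_preinductive (c_idem Y) ncY.
  have [p /copoint_compactE + cp] := kx _ copV => /(_ cp) Ve.
  have Pp : P p by split=> //; rewrite -Ve.
  have [y Yy [py _]] := PY _ Pp.
  have : V p.
    by apply: cYV; apply: closure_down py; exact: sub_closure.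
  by rewrite Ve; apply.
Qed.

End Preinductive.

Lemma representing_suprema x Y : separates_points c ->
  representing_antichain c x Y -> suprema Y x.
Proof.
move=> csep [_ _ [cYx Yx]]; split=> // u Yu.
apply: contrapT => /csep [V [cV Vu Vx]]; apply: Vx.
by apply: (closure_sub cV) cYx => y /Yu; exact: pclosed_down.
Qed.

(** * The Krein--Milman property *)

Lemma sub_up_preclosure A : A `<=` up_preclosure c A.
Proof.
move=> a Aa B _; case: (pselect (B a)) => Ba; last by right; exists a.
by left; apply: sub_closure.
Qed.

Lemma up_preclosure_mono A B :
  A `<=` B -> up_preclosure c A `<=` up_preclosure c B.
Proof.
move=> AB x + D _ => /(_ D I) [cx|[a [Aa Da] ax]].
- by left; apply: closure_mono cx => y [/AB].
- by right; exists a => //; split=> //; exact: AB.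
Qed.

Lemma kit_up_closed (c_preinductive : preinductive c) :
  pclosed (up_preclosure c) (kit_points c).
Proof.
apply/seteqP; split; last exact: sub_up_preclosure.
move=> x ux V copV; have [cV Vx maxV] := copV.
(* Testing against the copoint itself leaves only a kit point k <= x outside
   V; a copoint of k above V still misses x, so it is V. *)
have [/(closure_sub cV (@subIsetr _ _ _))//|[k [kk Vk] kx]] := ux V I.
have [W copW VW] := c_preinductive _ _ cV Vk.
have [cW Wk _] := copW.
have <- : W = V.
  by apply: maxV => // Wx; apply: Wk; exact: pclosed_down kx.
exact: kk.
Qed.

(** The test set [not_above p] witnesses that [p] leaves the hull of the
    remaining kit points. *)
Lemma compact_extreme :
  compact_points c `<=` extreme_points (up_preclosure c) (kit_points c).
Proof.
move=> p cp; split; first exact: compact_kit.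
move=> /(_ (not_above p) I) [].
- by move/compactP: cp => cp /(closure_sub cp (@subIsetr _ _ _)); apply.
- move=> [a [[_ nap] /contrapT pa] ap].
  by apply: nap; split.
Qed.

Lemma kit_krein_milman (c_preinductive : preinductive c)
    (c_idem : idempotent_preclosure c) :
  krein_milman (up_preclosure c) (kit_points c).
Proof.
apply/seteqP; split=> x; last first.
  rewrite -[in X in _ -> X](kit_up_closed c_preinductive).
  by apply: up_preclosure_mono => y [].
move=> /(kit_representing c_preinductive c_idem) [Y [_ cY [cYx Yx]]] B _.
case: (pselect (Y `<=` B)) => [YB|nYB].
- left; apply: closure_mono cYx => y Yy.
  by split; [exact/compact_extreme/cY | exact: YB].
- have [y Yy nBy] : exists2 y, Y y & ~ B y.
    apply: contrapT => nY; apply: nYB => y Yy; apply: contrapT => nBy.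
    by apply: nY; exists y.
  by right; exists y; [split=> //; exact/compact_extreme/cY | exact: Yx].
Qed.

(** The compact points below [x] include a representing antichain, of which
    [x] is already a supremum. *)
Lemma kit_sup_generated (c_preinductive : preinductive c)
    (c_idem : idempotent_preclosure c) : separates_points c ->
  sup_generated (kit_points c) (compact_points c).
Proof.
move=> csep; split; first exact: compact_kit.
move=> x /(kit_representing c_preinductive c_idem) [Y rY].
have [_ lub] := representing_suprema csep rY; have [_ cY [_ Yx]] := rY.
split; first by move=> p [[_ -> ]].
move=> u ub; apply: lub => y Yy; apply: ub; split; last exact: cY.
by exists x => //; exact: Yx.
Qed.

End Copoints.

Theorem theorem9p12 (d : Order.disp_t) (E : preorderType d)
    (c : set E -> set E)
    (c_enriched : enriched c)
    (c_idempotent : idempotent_preclosure c)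
    (c_preinductive : preinductive c) :
  [/\ pclosed (up_preclosure c) (kit_points c),
      krein_milman (up_preclosure c) (kit_points c),
      (forall x : E, kit_points c x ->
        [/\ exists Y : set E, representing_antichain c x Y,
            unique_up_to_order_equiv (representing_antichain c x)
          & finitary c ->
              forall Y : set E, representing_antichain c x Y -> finite_set Y])
    & separates_points c ->
        sup_generated (kit_points c) (compact_points c) /\
        (forall x : E, kit_points c x ->
           forall Y : set E, representing_antichain c x Y -> suprema Y x)].
Proof.
split.
- exact: kit_up_closed.
- exact: kit_krein_milman.
- move=> x kx; split.
  + exact: kit_representing.
  + exact: representing_unique.
  + by move=> cfin Y; exact: representing_finite.
- move=> csep; split; first exact: kit_sup_generated.
  by move=> x _ Y; exact: representing_suprema.
Qed.
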